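(* Let $p$ be an odd prime and let $G=(V,w)$ be a $p$-periodic weighted graph with quotient graph $\overline G$. Then, reducing coefficients modulo $p$, $$\varphi_G(x)=\varphi_{\overline G}(x^p)\quad\text{in } \mathbb{F}_p[x].$$
   Context: A weighted graph is a pair $G=(V,w)$ where $V=\{v_1,\dots,v_n\}$ is a finite set and $w:V\times V\to \mathbb{Z}_{\ge 0}$ is a symmetric function (equivalently, a finite graph possibly with multiple edges and loops). Its adjacency matrix is the $n\times n$ integer matrix $A(G)=[w(v_i,v_j)]$, and $\varphi_G(x)=\det(xI_n-A(G))\in\mathbb{Z}[x]$ is its characteristic polynomial (independent of the ordering of vertices). An automorphism of $G$ is a permutation $\sigma$ of $V$ with $w(\sigma(u),\sigma(v))=w(u,v)$ for all $u,v$. For an integer $p\ge2$, $G$ is called $p$-periodic if there is an automorphism $h$ with $h^p=\mathrm{Id}$ and $h^i(v)\neq v$ for all $v\in V$ and all $1\le i\le p-1$. The quotient graph $\overline G=(\overline V,\overline w)$ has vertex set $\overline V$ the set of orbits of $V$ under $\langle h\rangle$, and weight $\overline w(\overline u,\overline v)=\sum_{i=0}^{p-1}w(u,h^i(v))$, where $u,v$ are any representatives of the orbits $\overline u,\overline v$. *)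

(* Defs.v *)
From HB Require Import structures.
From mathcomp Require Import all_boot all_order all_algebra all_fingroup.

Set Implicit Arguments.
Unset Strict Implicit.
Unset Printing Implicit Defensive.

Import GRing.Theory.

Local Open Scope ring_scope.

Record wgraph := WGraph {
  vertex :> finType;
  weight : vertex -> vertex -> nat;
  weight_sym : forall u v, weight u v = weight v u
}.

Definition adjmx (G : wgraph) : 'M[int]_#|G| :=
  \matrix_(i, j) (weight (enum_val i : G) (enum_val j))%:Z.

Definition graph_char_poly (G : wgraph) : {poly int} := char_poly (adjmx G).

Definition automorphism (G : wgraph) (h : {perm G}) : Prop :=
  forall u v : G, weight (h u) (h v) = weight u v.

Definition periodic_aut (p : nat) (G : wgraph) (h : {perm G}) : Prop :=
  [/\ automorphism h,
      (h ^+ p = 1)%g &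
      forall (v : G) (i : nat), (0 < i < p)%N -> (h ^+ i)%g v <> v].

Section Quotient.

Variables (p : nat) (G : wgraph) (h : {perm G}).

Definition orbit_type : finType := {U : {set G} | U \in porbits h}.

Definition orbit_of (v : G) : orbit_type :=
  Sub (porbit h v) (imset_f (porbit h) (erefl : v \in predT)).

Lemma orbit_neq0 (U : orbit_type) : exists v, v \in val U.
Proof. by case: U => U /= /imsetP[v _ ->]; exists v; apply: porbit_id. Qed.

Definition orbit_repr (U : orbit_type) : G := xchoose (orbit_neq0 U).

(* The choice of representatives is immaterial: see quotient_weightE. *)
Definition quotient_weight (U W : orbit_type) : nat :=
  (\sum_(i < p) weight (orbit_repr U) ((h ^+ i)%g (orbit_repr W)))%N.

Hypothesis hP : periodic_aut p h.

Lemma weight_autX (k : nat) (u v : G) :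
  weight ((h ^+ k)%g u) ((h ^+ k)%g v) = weight u v.
Proof.
by case: hP => autoh _ _; elim: k => [|k IHk]; rewrite ?perm1 // !expgSr !permM autoh.
Qed.

Lemma sum_weight_shift (k : nat) (u v : G) :
  (\sum_(i < p) weight u ((h ^+ (i + k))%g v) =
   \sum_(i < p) weight u ((h ^+ i)%g v))%N.
Proof.
case: hP => _ hp1 _; elim: k => [|k IHk].
  by apply: eq_bigr => i _; rewrite addn0.
rewrite -{}IHk; case: p hp1 => [|q] hq1; first by rewrite !big_ord0.
rewrite big_ord_recr big_ord_recl /= addnC; congr (_ + _)%N.
  by rewrite addnS -addSn expgD hq1 mul1g.
by apply: eq_bigr => i _; rewrite /bump /= add1n addnS addSn.
Qed.

Lemma quotient_weight_sym U W : quotient_weight U W = quotient_weight W U.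
Proof.
rewrite /quotient_weight; set u := orbit_repr U; set v := orbit_repr W.
have [_ hp1 _] := hP.
rewrite (reindex_inj rev_ord_inj) -(sum_weight_shift 1) /=.
apply: eq_bigr => i _; rewrite weight_sym -(weight_autX (p - i.+1) _ ((h ^+ _)%g u)).
by rewrite -permM -expgD addn1 subnKC ?ltn_ord // hp1 perm1.
Qed.

Lemma quotient_weightE (u v : G) :
  quotient_weight (orbit_of u) (orbit_of v) =
  (\sum_(i < p) weight u ((h ^+ i)%g v))%N.
Proof.
rewrite /quotient_weight.
have reprE x : exists k, orbit_repr (orbit_of x) = (h ^+ k)%g x.
  by apply/porbitP; apply: (xchooseP (orbit_neq0 (orbit_of x))).
have [k ->] := reprE u; have [l ->] := reprE v.
rewrite -[LHS](sum_weight_shift k) -[RHS](sum_weight_shift l).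
apply: eq_bigr => i _.
by rewrite -permM -expgD addnA [in LHS]expgD permM weight_autX addnC.
Qed.

Definition quotient_graph : wgraph := WGraph quotient_weight_sym.

End Quotient.

Definition reduce_mod (p : nat) (f : {poly int}) : {poly 'F_p} :=
  map_poly (intr : int -> 'F_p) f.

(* Main.v *)
(** Enumerate the vertices as [h^i r] with [i < p] and [r] running over orbit
    representatives: [x I - A(G)] becomes block circulant, that is, multiplication
    by [b(T) = \sum_k B_k T^k] over the group ring of the cyclic group of order
    [p].  In characteristic [p] that ring is [F_p[T]/(T - 1)^p], and in the basis
    of powers of [T - 1] multiplication by [b(T)] is block triangular with all
    diagonal blocks equal to [b(1) = x I - A(G/h)].  Hence [phi_G] is the [p]-th
    power of the characteristic polynomial of the quotient, and Frobenius turns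
    this power into the substitution of [x^p] for [x]. *)
Require Import Defs.
From mathcomp Require Import all_boot all_order all_algebra all_fingroup.
From mathcomp Require Import finfield.

Set Implicit Arguments.
Unset Strict Implicit.
Unset Printing Implicit Defensive.

Import GRing.Theory.

Local Open Scope ring_scope.

Section Determinants.

Variable R : comPzRingType.

(** The same permutation acts on rows and on columns, so its sign enters twice and cancels. *)
Lemma det_mxsub_bij n n' (A : 'M[R]_n') (f : 'I_n -> 'I_n') :
  bijective f -> \det (mxsub f f A) = \det A.
Proof.
move=> bij_f; have /eqP := bij_eq_card bij_f; rewrite !card_ord => /eqP en.
case: _ / en A f bij_f => A f bij_f.
pose s := perm (bij_inj bij_f).
have -> : mxsub f f A = row_perm s (col_perm s A).
  by apply/matrixP => i j; rewrite !mxE !permE.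
rewrite row_permE col_permE !det_mulmx !det_perm mulrCA odd_permV.
by rewrite -signr_addb addbb mulr1.
Qed.

Lemma det_castmx_sq n n' (e e' : n = n') (A : 'M[R]_n) :
  \det (castmx (e, e') A) = \det A.
Proof. by case: _ / e e' => e'; rewrite (eq_axiomK e') castmx_id. Qed.

Lemma det_mxblock_utrig m p (B : 'I_p -> 'I_p -> 'M[R]_m) :
    (forall i j : 'I_p, (j < i)%N -> B i j = 0) ->
  \det (\mxblock_(i, j) B i j) = \prod_(i < p) \det (B i i).
Proof.
elim: p B => [|p IHp] B B0.
  rewrite big_ord0; move: (\mxblock_(i, j) _).
  by rewrite big_ord0 => A; rewrite det_mx00.
rewrite mxblock_recul det_castmx_sq big_ord_recl.
have -> : \mxcol_(i < p) B (lift ord0 i) ord0 = 0.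
  by apply/matrixP => i j; rewrite !mxE B0 // mxE.
by rewrite det_ublock IHp // => i j ij; apply: B0.
Qed.

Lemma det_mxblock_ltrig m p (B : 'I_p -> 'I_p -> 'M[R]_m) :
    (forall i j : 'I_p, (i < j)%N -> B i j = 0) ->
  \det (\mxblock_(i, j) B i j) = \prod_(i < p) \det (B i i).
Proof.
move=> B0; rewrite -det_tr tr_mxblock det_mxblock_utrig => [|i j /B0-> //]; last exact: trmx0.
by apply: eq_bigr => i _; rewrite det_tr.
Qed.

End Determinants.

(** Since [(1 + T)^p = 1 + T^p] in characteristic [p], multiplying by it leaves the coefficients
    below degree [p] unchanged. *)
Lemma natr_bin_modp (R : nzSemiRingType) p n j : p \in [pchar R] -> (j < p)%N ->
  'C(n %% p, j)%:R = 'C(n, j)%:R :> R.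
Proof.
move=> charRp lt_jp.
rewrite [in RHS](divn_eq n p); elim: (n %/ p)%N => [|q ->]; first by rewrite add0n.
rewrite mulSn -addnA; set a := (_ + _)%N.
rewrite -binomial.Vandermonde natr_sum big_ord_recl /= bin0 mul1n subn0 big1 ?addr0 // => i _.
have lt_ip : (bump 0 i < p)%N by apply: leq_ltn_trans lt_jp; rewrite /bump add1n.
by rewrite natrM bin_lt_pcharf_0 ?mul0r // lt_ip /bump.
Qed.

Section BlockCirculant.

Variables (R : comNzRingType) (p m : nat).
Hypothesis charRp : p \in [pchar R].
Variable B : nat -> 'M[R]_m.

Lemma det_block_circulant :
  \det (\mxblock_(i < p, j < p) B ((j + (p - i)) %% p)) =
  \det (\sum_(l < p) B l) ^+ p.
Proof.
(* [t k] is the coefficient of [(T - 1)^k] in [\sum_l T^l B_l]; [Q] expresses the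
   powers of [T] in terms of those of [T - 1]. *)
pose t k := \sum_(l < p) ('C(l, k)%:R : R) *: B l.
pose Q := \mxblock_(i < p, j < p) ('C(i, j)%:R%:M : 'M[R]_m).
pose L := \mxblock_(i < p, j < p) if (i <= j)%N then t (j - i)%N else 0.
have p_gt0 : (0 < p)%N by rewrite prime_gt0 // (pcharf_prime charRp).
have detQ : \det Q = 1.
  rewrite det_mxblock_ltrig => [|i j lt_ij].
    by rewrite big1 // => i _; rewrite binn det1.
  by rewrite bin_small ?raddf0.
have detL : \det L = \det (t 0%N) ^+ p.
  rewrite det_mxblock_utrig => [|i j lt_ji]; last by rewrite leqNgt lt_ji.
  rewrite (eq_bigr (fun=> \det (t 0%N))) ?prodr_const ?card_ord // => i _.
  by rewrite leqnn subnn.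
have -> : \sum_(l < p) B l = t 0%N.
  by apply: eq_bigr => l _; rewrite bin0 scale1r.
rewrite -detL -[LHS]mulr1 -[RHS]mul1r -detQ -!det_mulmx; congr (\det _).
rewrite !mul_mxblock; apply/eq_mxblock => i j.
(* The goal says that the circulant times [Q] is [Q *m L]. Block [(i, j)] of either side is the
   coefficient of [(T - 1)^j] in [T^i b(T)]: on the left by the shift [l + i] modulo [p], on the
   right by Vandermonde. *)
transitivity (\sum_(l < p) ('C(l + i, j)%:R : R) *: B l).
  pose s (l : 'I_p) : 'I_p := Ordinal (ltn_pmod (l + i) p_gt0).
  have s_inj : injective s.
    move=> l l' /(congr1 val) /= /eqP; rewrite eqn_modDr => /eqP.
    by rewrite !modn_small // => /val_inj.
  rewrite (reindex_inj s_inj); apply: eq_bigr => l _.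
  rewrite mul_mx_scalar natr_bin_modp //; congr (_ *: B _).
  by rewrite modnDml -addnA subnKC 1?ltnW // modnDr modn_small.
transitivity (\sum_(l < p) \sum_(k < p)
    if (k <= j)%N then ('C(i, k) * 'C(l, j - k))%:R *: B l else 0); last first.
  rewrite exchange_big; apply: eq_bigr => k _; rewrite mul_scalar_mx.
  case: ifP => _; last by rewrite scaler0 big1.
  by rewrite scaler_sumr; apply: eq_bigr => l _; rewrite scalerA natrM.
apply: eq_bigr => l _; rewrite addnC -binomial.Vandermonde natr_sum scaler_suml.
pose F k := ('C(i, k) * 'C(l, j - k))%:R *: B l.
rewrite (big_ord_widen p F) ?ltn_ord //.
by rewrite big_mkcond.
Qed.

End BlockCirculant.

(** Frobenius is a ring morphism, and it fixes the coefficients by Fermat's little theorem. *)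
Lemma Fp_poly_expp p (f : {poly 'F_p}) : prime p -> f ^+ p = f \Po 'X^p.
Proof.
move=> p_pr; have charFp : p \in [pchar {poly 'F_p}] by rewrite pchar_poly pchar_Fp.
elim/poly_ind: f => [|f c IHf]; first by rewrite comp_poly0 expr0n eqn0Ngt prime_gt0.
rewrite comp_poly_MXaddC -IHf -!(pFrobenius_autE charFp) rmorphD rmorphM /=.
by rewrite !pFrobenius_autE -polyC_exp -[in X in c ^+ X](card_Fp p_pr) expf_card.
Qed.

Section Periodic.

Variables (p : nat) (G : wgraph) (h : {perm G}).
Hypothesis p_pr : prime p.
Hypothesis hP : periodic_aut p h.

Let m := #|quotient_graph hP|.

Let rep (k : 'I_m) : G := orbit_repr (enum_val k).

Let vtx (s : 'I_(\sum_(i < p) m)) : 'I_#|G| :=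
  enum_rank ((h ^+ tagnat.sig1 s)%g (rep (tagnat.sig2 s))).

Lemma porbit_rep k : porbit h (rep k) = val (enum_val k).
Proof.
have := xchooseP (orbit_neq0 (enum_val k)); rewrite -/(orbit_repr _) -/(rep k).
by case: (enum_val k) => U /= /imsetP[v _ ->]; rewrite -eq_porbit_mem => /eqP.
Qed.

(** Equal points share an orbit, hence a representative; freeness of the action then forces equal
    exponents. *)
Lemma expg_rep_inj (i j : 'I_p) k l :
  (h ^+ i)%g (rep k) = (h ^+ j)%g (rep l) -> i = j /\ k = l.
Proof.
move=> eq_ij; have kl : k = l.
  apply/enum_val_inj/val_inj; rewrite -!porbit_rep.
  by rewrite -(porbit_perm _ i) eq_ij porbit_perm.
split=> //; rewrite {k}kl in eq_ij; apply: val_inj => /=.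
have [_ _ free] := hP.
wlog le_ij : i j eq_ij / (i <= j)%N.
  by move=> IH; have [/IH->|/ltnW/IH->] := leqP i j.
apply/eqP; rewrite eqn_leq le_ij leqNgt; apply/negP => lt_ij.
case: (free (rep l) (j - i)%N).
  by rewrite subn_gt0 lt_ij (leq_ltn_trans (leq_subr _ _)).
by apply: (@perm_inj _ (h ^+ i)%g); rewrite -permM -expgD subnK.
Qed.

Lemma orbit_vertex_inj : injective vtx.
Proof.
move=> s t /enum_rank_inj/expg_rep_inj[eq1 eq2].
apply/val_inj/eqP; rewrite -(tagnat.sig2K s) -(tagnat.sig2K t) tagnat.eq_Rank.
by rewrite eq1 eq2 !eqxx.
Qed.

Lemma orbit_vertex_bij : bijective vtx.
Proof.
have [_ hp1 _] := hP.
have surj y : exists s, vtx s == y.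
  pose v : G := enum_val y; pose k : 'I_m := enum_rank (orbit_of h v).
  have : v \in porbit h (rep k) by rewrite porbit_rep enum_rankK porbit_id.
  case/porbitP=> i def_v.
  (* [porbitP] gives an arbitrary exponent, reduced modulo [p] thanks to [h ^+ p = 1]. *)
  exists (tagnat.Rank (Ordinal (ltn_pmod i (prime_gt0 p_pr))) k).
  rewrite -[y]enum_valK -/v def_v /vtx tagnat.Rank1K /= expg_mod //.
  apply/eqP; congr (enum_rank (_ (rep _))).
  by apply: val_inj; rewrite tagnat.Rank2K.
exists (fun y => xchoose (surj y)) => [s|y]; last exact/eqP/(xchooseP (surj y)).
exact/orbit_vertex_inj/eqP/(xchooseP (surj (vtx s))).
Qed.

Lemma char_poly_periodic (R : comNzRingType) (f : {rmorphism int -> R}) :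
    p \in [pchar R] ->
  char_poly (map_mx f (adjmx G)) =
  char_poly (map_mx f (adjmx (quotient_graph hP))) ^+ p.
Proof.
move=> charRp; have [_ hp1 _] := hP; have p_gt0 := prime_gt0 p_pr.
(* [B k] pairs [rep u] with the [h ^+ k] translate of [rep v]; these coincide only for [k = 0] and
   [u = v], whence the condition on ['X]. *)
pose B k : 'M[{poly R}]_m := \matrix_(u, v)
  ('X *+ ((k == 0%N) && (u == v)) - (f (weight (rep u) ((h ^+ k)%g (rep v)))%:Z)%:P).
rewrite /char_poly -(det_mxsub_bij _ orbit_vertex_bij).
have -> : char_poly_mx (map_mx f (adjmx (quotient_graph hP))) = \sum_(l < p) B l.
  apply/matrixP => u v; rewrite summxE; under eq_bigr do rewrite !mxE.
  rewrite sumrB !mxE; congr (_ - _).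
    rewrite (bigD1 (Ordinal p_gt0)) //= big1 ?addr0 // => l.
    by rewrite -val_eqE => /negPf /= ->.
  by rewrite (big_morph Posz PoszD (erefl _)) !rmorph_sum.
rewrite -det_block_circulant ?pchar_poly //; congr (\det _).
apply/matrixP => s t; rewrite !mxE.
have -> : (vtx s == vtx t) = (s == t) by rewrite (inj_eq orbit_vertex_inj).
congr (_ *+ nat_of_bool _ - (f _%:Z)%:P).
  rewrite -{1}(tagnat.sig2K s) -{1}(tagnat.sig2K t) -val_eqE tagnat.eq_Rank.
  set i := tagnat.sig1 s; set j := tagnat.sig1 t; congr (_ && _).
  (* Writing 0 in this form lets [p - i] cancel: the block index vanishes exactly when [i = j]. *)
  have -> : 0%N = ((i + (p - i)) %% p)%N by rewrite subnKC ?modnn // ltnW.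
  by rewrite eqn_modDr !modn_small // eq_sym.
(* The block index is [j - i] modulo [p]; applying [h ^+ i] to both vertices turns the weight from
   [u] to [h^(j-i) v] into that from [h^i u] to [h^j v]. *)
rewrite !enum_rankK -[RHS](weight_autX hP (tagnat.sig1 s)).
by rewrite expg_mod // -permM -expgD -addnA subnK 1?ltnW // expgD hp1 mulg1.
Qed.

End Periodic.

Theorem theorem1p1 (p : nat) (p_prime : prime p) (p_odd : odd p)
    (G : wgraph) (h : {perm G}) (hP : periodic_aut p h) :
  reduce_mod p (graph_char_poly G) =
  reduce_mod p (graph_char_poly (quotient_graph hP)) \Po 'X^p.
Proof.
rewrite -Fp_poly_expp // /reduce_mod /graph_char_poly !map_char_poly.
exact/char_poly_periodic/pchar_Fp.
Qed.
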